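(* Let $d\ge2$, $0<p<q<\infty$, and let $w$ be a doubling weight on $\mathbb{S}^{d-1}$ for which there is a constant $c_w'>0$ with $$\min_{x\in\mathbb{S}^{d-1}}w(B(x,n^{-1}))\le c_w'\,n^{-s_w},\qquad n=1,2,\dots.$$ Then for every $\nu'$ with $0<\nu'<\nu:=s_w(\frac1p-\frac1q)$ there exists a function $f$ such that $f\in B^{\nu'}_\tau(L_{p,w})$ for all $\tau>0$, but $f\notin L_{q,w}$.
   Context: $\mathbb{S}^{d-1}$ is the unit sphere of $\mathbb{R}^d$ with rotation-invariant surface measure $d\sigma$; $B(x,t)=\{y\in\mathbb{S}^{d-1}:\arccos(x\cdot y)\le t\}$ is the spherical cap and $cB(x,t)=B(x,ct)$ (the whole sphere if $ct\ge\pi$). For a weight (nonnegative integrable function) $w$, $w(E)=\int_Ew\,d\sigma$, and $L_{p,w}$ is the space of real functions with finite $\|f\|_{p,w}=(\int|f|^pw\,d\sigma)^{1/p}$. The weight $w$ is doubling if there is $L>0$ with $w(2B)\le L\,w(B)$ for all spherical caps $B$; the least such $L$ is $L_w$. Doubling weights are normalized by $\int w\,d\sigma=1$. Define $s_w'=\inf\{s\ge0:\ \sup_{m\in\mathbb{N}}\sup_B\frac{w(2^mB)}{2^{ms}w(B)}<\infty\}$, the inner supremum over all spherical caps $B$. Set $s_w=s_w'$ if this infimum is attained; otherwise $s_w$ is a fixed number with $s_w'<s_w\le\log L_w/\log2$. $\Pi_n^d$ is the space of restrictions to $\mathbb{S}^{d-1}$ of real polynomials in $d$ variables of total degree at most $n$,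 and $E_n(f)_{p,w}=\inf_{g\in\Pi_n^d}\|f-g\|_{p,w}$. For $\nu>0$, $0<\tau\le\infty$, the weighted Besov space $B^\nu_\tau(L_{p,w})$ consists of all $f\in L_{p,w}$ with finite quasi-norm $\|f\|_{p,w}+\bigl(\sum_{j=0}^\infty2^{j\nu\tau}E_{2^j}(f)_{p,w}^\tau\bigr)^{1/\tau}$ (usual modification when $\tau=\infty$). *)

(* Defs.v *)
From HB Require Import structures.
From mathcomp Require Import all_boot all_order all_algebra.
From mathcomp Require Import all_classical all_reals all_analysis.
From mathcomp Require Import measurable_realfun.
From mathcomp Require mpoly.

Set Implicit Arguments.
Unset Strict Implicit.
Unset Printing Implicit Defensive.

Import Order.TTheory GRing.Theory Num.Theory.
Import numFieldNormedType.Exports.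

Local Open Scope classical_set_scope.
Local Open Scope ring_scope.

(* R^d; the sigma-algebra of a tuple type is the product one, that is, the
   Borel sigma-algebra of R^d. *)
Notation euclid R d := (d.-tuple (measurableTypeR R)).

Section lebesgue_measure_Rd.
Context (R : realType).
Local Open Scope ereal_scope.

Definition cons_pair d (x : measurableTypeR R * euclid R d) : euclid R d.+1 :=
  [tuple of x.1 :: x.2].

Lemma measurable_cons_pair d : measurable_fun setT (@cons_pair d).
Proof. exact: measurable_cons. Qed.

Definition uncons_pair d (x : euclid R d.+1) : measurableTypeR R * euclid R d :=
  (thead x, [tuple of behead x]).

Lemma cons_pairK d : cancel (@cons_pair d) (@uncons_pair d).
Proof. by move=> [a x]; congr pair; apply/val_inj. Qed.

Lemma measurable_uncons_pair d : measurable_fun setT (@uncons_pair d).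
Proof.
apply/measurable_fun_pairP; split.
  exact: (measurable_tnth ord0).
exact: measurable_behead.
Qed.

Section leb_step.
Variables (d : nat) (mu : {sigma_finite_measure set (euclid R d) -> \bar R}).

Definition leb_step : set (euclid R d.+1) -> \bar R :=
  pushforward (@lebesgue_measure R \x mu) (@cons_pair d).

HB.instance Definition _ := isMeasurableFun.Build _ _ _ _ (@cons_pair d)
  (@measurable_cons_pair d).

Let leb_step0 : leb_step set0 = 0.
Proof. by rewrite /leb_step /pushforward preimage_set0 measure0. Qed.

Let leb_step_ge0 A : 0 <= leb_step A.
Proof. exact: measure_ge0. Qed.

Let leb_step_sigma_additive : semi_sigma_additive leb_step.
Proof.
exact: (measure_semi_sigma_additive
  (s := pushforward (@lebesgue_measure R \x mu) (@cons_pair d))).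
Qed.

HB.instance Definition _ := isMeasure.Build _ _ _ leb_step
  leb_step0 leb_step_ge0 leb_step_sigma_additive.

Let leb_step_sigma_finite : sigma_finite setT leb_step.
Proof.
have /sigma_finiteP[F [TF ndF Foo]] := sigma_finiteT (@lebesgue_measure R).
have /sigma_finiteP[G [TG ndG Goo]] := sigma_finiteT mu.
exists (fun n => @uncons_pair d @^-1` (F n `*` G n)).
  apply/seteqP; split=> // x _.
  have : [set: _] (thead x) by [].
  have : [set: _] ([tuple of behead x] : euclid R d) by [].
  rewrite [X in X (thead x)]TF [X in X _]TG => -[k _ Gky] [n _ Fnx].
  exists (maxn n k) => //; split => /=.
    by move: Fnx; exact/subsetPset/ndF/leq_maxl.
  by move: Gky; exact/subsetPset/ndG/leq_maxr.
move=> k; have [mF Fk] := Foo k; have [mG Gk] := Goo k; split.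
  rewrite -[X in measurable X]setTI; apply: measurable_uncons_pair => //.
  exact: measurableX.
rewrite /leb_step /pushforward -comp_preimage (_ : _ \o _ = id); last first.
  by apply/funext => x /=; rewrite cons_pairK.
by rewrite preimage_id product_measure1E// lte_mul_pinfty// ge0_fin_numE.
Qed.

HB.instance Definition _ := Measure_isSigmaFinite.Build _ _ _ leb_step
  leb_step_sigma_finite.

End leb_step.

(* d-dimensional Lebesgue measure, as an iterated product *)
Fixpoint leb d : {sigma_finite_measure set (euclid R d) -> \bar R} :=
  if d is d'.+1 then leb_step (leb d') else \d_([tuple] : euclid R 0).

End lebesgue_measure_Rd.

Section sphere.
Context (R : realType) (d : nat).
Implicit Types x y : euclid R d.

Definition dot x y : R := \sum_(i < d) tnth x i * tnth y i.

Definition norm2 x : R := Num.sqrt (dot x x).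

Definition sphere : set (euclid R d) := [set x | norm2 x = 1].

Definition normalize x : euclid R d := [tuple tnth x i / norm2 x | i < d].

Definition punctured_ball : set (euclid R d) := [set x | 0 < norm2 x <= 1].

Lemma measurable_norm2 : measurable_fun setT norm2.
Proof.
apply: (@measurableT_comp _ _ _ _ _ _ (@Num.sqrt R)).
  by apply: continuous_measurable_fun; exact: sqrt_continuous.
apply: measurable_sum => i.
by apply: measurable_funM; exact: measurable_tnth.
Qed.

Lemma measurable_punctured_ball : measurable punctured_ball.
Proof.
rewrite (_ : punctured_ball = norm2 @^-1` `]0, 1]); last first.
  by apply/seteqP; split => x /=; rewrite in_itv.
by rewrite -[X in measurable X]setTI; exact: measurable_norm2.
Qed.

Lemma measurable_normalize : measurable_fun setT normalize.
Proof.
apply/measurable_fun_tnthP => i.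
rewrite (_ : _ \o _ = fun x => tnth x i / norm2 x); last first.
  by apply/funext => x /=; rewrite tnth_mktuple.
apply: measurable_funM; first exact: measurable_tnth.
rewrite (_ : (fun x => (norm2 x)^-1) = fun x => norm2 x `^ (-1)); last first.
  by apply/funext => x; rewrite powR_inv1// sqrtr_ge0.
apply: (@measurableT_comp _ _ _ _ _ _ (@powR R ^~ (-1))) => //.
exact: measurable_norm2.
Qed.

Local Open Scope ereal_scope.

(* Surface measure: d times the volume of the cone {r x | x in E, 0 < r <= 1};
   it is a measure on R^d carried by the sphere. *)
Definition surface (E : set (euclid R d)) : \bar R :=
  (d%:R)%:E * @leb R d (normalize @^-1` E `&` punctured_ball).

Definition cone_measure : set (euclid R d) -> \bar R := pushforward
  (mrestr (@leb R d) measurable_punctured_ball) normalize.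

HB.instance Definition _ := isMeasurableFun.Build _ _ _ _ normalize
  measurable_normalize.

Let cone_measure0 : cone_measure set0 = 0.
Proof. exact: measure0. Qed.

Let cone_measure_ge0 A : 0 <= cone_measure A.
Proof. exact: measure_ge0. Qed.

Let cone_measure_sigma_additive : semi_sigma_additive cone_measure.
Proof. exact: measure_semi_sigma_additive. Qed.

HB.instance Definition _ := isMeasure.Build _ _ _ cone_measure
  cone_measure0 cone_measure_ge0 cone_measure_sigma_additive.

Let surfaceE : surface = mscale (NngNum (ler0n R d)) cone_measure.
Proof. by []. Qed.

Let surface0 : surface set0 = 0.
Proof. by rewrite surfaceE measure0. Qed.

Let surface_ge0 A : 0 <= surface A.
Proof. by rewrite surfaceE measure_ge0. Qed.

Let surface_sigma_additive : semi_sigma_additive surface.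
Proof. by rewrite surfaceE; exact: measure_semi_sigma_additive. Qed.

HB.instance Definition _ := isMeasure.Build _ _ _ surface
  surface0 surface_ge0 surface_sigma_additive.

End sphere.

Definition cap (R : realType) d (x : euclid R d) (t : R) : set (euclid R d) :=
  [set y | sphere y /\ acos (dot x y) <= t].

(* Functions on the sphere are represented by functions on R^d, of which only
   the values on the sphere are used. *)
Section weights.
Context (R : realType) (d : nat) (w : euclid R d -> R).

(* centres and radii of the spherical caps; the degenerate radius 0 is excluded,
   so that the caps have positive mass for a doubling weight *)
Definition cap_params : set (euclid R d * R) :=
  [set b | sphere b.1 /\ 0 < b.2].

Definition wmass (E : set (euclid R d)) : R := \int[@surface R d]_(x in E) w x.

Definition doubling_with (L : R) :=
  forall b, cap_params b ->
    wmass (cap b.1 (2 * b.2)) <= L * wmass (cap b.1 b.2).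

Definition doubling_constants : set R := [set L | 0 < L /\ doubling_with L].

Definition doubling_weight : Prop :=
  [/\ forall x, sphere x -> 0 <= w x,
      (@surface R d).-integrable (@sphere R d) (EFin \o w),
      doubling_constants !=set0 &
      wmass (@sphere R d) = 1].

Definition doubling_constant : R := inf doubling_constants.

Definition growth_ratio (s : R) (m : nat) (b : euclid R d * R) : R :=
  wmass (cap b.1 (2 ^+ m * b.2)) / (2 `^ (m%:R * s) * wmass (cap b.1 b.2)).

Definition growth_exponents : set R :=
  [set s | 0 <= s /\
    (ereal_sup [set ereal_sup [set (growth_ratio s m b)%:E | b in cap_params]
               | m in [set: nat]] < +oo)%E].

Definition inf_growth_exponent : R := inf growth_exponents.

(* s is an admissible choice of the exponent s_w, which is a free choice in an
   interval when the infimum is not attained *)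
Definition is_growth_exponent (s : R) : Prop :=
  (growth_exponents inf_growth_exponent -> s = inf_growth_exponent) /\
  (~ growth_exponents inf_growth_exponent ->
    inf_growth_exponent < s <= ln doubling_constant / ln 2).

Local Open Scope ereal_scope.

Definition wnorm (p : R) (f : euclid R d -> R) : \bar R :=
  (\int[@surface R d]_(x in @sphere R d) (`|f x| `^ p * w x)%:E) `^ p^-1.

Definition Lpw (p : R) : set (euclid R d -> R) :=
  [set f | measurable_fun (@sphere R d) f /\ wnorm p f < +oo].

(* restrictions of polynomials of total degree at most n *)
Definition polys (n : nat) : set (euclid R d -> R) :=
  [set (fun x => mpoly.meval (tnth x) P) |
    P in [set P : mpoly.mpoly d R |
           forall m, (mpoly.mcoeff m P != 0)%R -> (mpoly.mdeg m <= n)%N]].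

Definition best_approx (n : nat) (p : R) (f : euclid R d -> R) : \bar R :=
  ereal_inf [set wnorm p (f \- g)%R | g in polys n].

(* the Besov seminorm; the secondary index ranges over 0 < tau <= +oo *)
Definition besov_seminorm (nu : R) (tau : \bar R) (p : R) (f : euclid R d -> R)
    : \bar R :=
  match tau with
  | t%:E => (\sum_(0 <= j <oo)
      (2 `^ (j%:R * nu * t))%:E * best_approx (2 ^ j) p f `^ t) `^ t^-1
  | _ => ereal_sup [set (2 `^ (j%:R * nu))%:E * best_approx (2 ^ j) p f
                   | j in [set: nat]]
  end.

Definition besov (nu : R) (tau : \bar R) (p : R) : set (euclid R d -> R) :=
  [set f | Lpw p f /\ wnorm p f + besov_seminorm nu tau p f < +oo].

End weights.

(* Main.v *)
(** Let x_k be a centre at which w(B(x_k, 2^-k)) is minimal, hence at most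
c 2^(-k s_w).  A power of the Dirichlet kernel, y |-> (D_n(x_k . y) / n)^(2r) with
n = 2^k, is a nonnegative polynomial on the sphere that is at least 1 on the
cap B(x_k, 2^-k) and decays like (n theta)^(-2r) away from it; for r large this
decay beats the doubling constant, so the p-th power of its L_{p,w} norm is
comparable to the mass of the cap.  Normalize these bumps to have L_{p,w} norm of
order 2^(-k mu), with nu' < mu < nu, and let f be their sum.  The tail of the series
controls the best approximation, E_{2^j}(f) <= C 2^(-j mu), which gives every
Besov condition of order nu'.  All terms being nonnegative, the norm of f in
L_{q,w} dominates that of each bump, and these are at least
c' 2^(k (nu - mu)), which is unbounded. *)

Require Import Defs.
From mathcomp Require Import all_boot all_order all_algebra.
From mathcomp Require Import all_classical all_reals all_analysis.
From mathcomp Require Import measurable_realfun.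
From mathcomp Require Import ring lra.
From mathcomp Require mpoly.

Set Implicit Arguments.
Unset Strict Implicit.
Unset Printing Implicit Defensive.

Import Order.TTheory GRing.Theory Num.Theory.
Import numFieldNormedType.Exports.
Import (canonicals, coercions) mpoly.

Local Open Scope classical_set_scope.
Local Open Scope ring_scope.

(** * Elementary bounds for sine and cosine *)

Section trigonometric_bounds.
Context {R : realType}.
Implicit Types x : R.

Lemma sin_MVT x : 0 <= x -> exists2 c, 0 <= c <= x & sin x = cos c * x.
Proof.
move=> x0; have [|c] := @MVT_segment R sin cos 0 x x0 (fun y _ => is_derive_sin y).
  by apply: continuous_subspaceT => y; exact: continuous_sin.
by rewrite in_itv/= sin0 !subr0 => cx sE; exists c.
Qed.

Lemma sin_le_id x : 0 <= x -> sin x <= x.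
Proof.
move=> x0; have [c _ ->] := sin_MVT x0.
by rewrite ler_piMl// cos_le1.
Qed.

(** Since cos x = 1 - 2 sin^2(x/2) and 0 <= sin(x/2) <= x/2 <= 1/2. *)
Lemma cos_ge_half x : 0 <= x <= 1 -> 2^-1 <= cos x.
Proof.
move=> /andP[x0 x1].
have -> : x = (x / 2) *+ 2 by rewrite -mulr_natr divfK.
rewrite cos_mulr2n cos2sin2.
have h0 : 0 <= x / 2 by rewrite divr_ge0.
have h1 : sin (x / 2) <= x / 2 by exact: sin_le_id.
have h2 : 0 <= sin (x / 2).
  apply: sin_ge0_pi; rewrite h0/=.
  by have := @pi_ge2 R; lra.
nra.
Qed.

(** On [0, 1] the mean value theorem and [cos_ge_half] give sin x >= x/2. Beyond 1, monotonicity
    gives sin x > sin 1 >= 1/2, while x/4 < 1/2 because pi/2 < 2. *)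
Lemma sin_ge_quarter x : 0 <= x <= pi / 2 -> x / 4 <= sin x.
Proof.
move=> /andP[x0 xpi].
have h (y : R) : 0 <= y <= 1 -> y / 2 <= sin y.
  move=> /andP[y0 y1]; have [c /andP[c0 cy] ->] := sin_MVT y0.
  have : 2^-1 <= cos c by apply: cos_ge_half; rewrite c0 (le_trans cy).
  nra.
have [x1|x1] := leP x 1.
  by have := h x; rewrite x0 x1 => /(_ isT); lra.
have := h 1; rewrite ler01 lexx => /(_ isT) s1.
have : sin 1 < sin x.
  rewrite ltr_sin ?in_itv//=; have := @pi_ge2 R; lra.
have := @pihalf_lt2 R; lra.
Qed.

End trigonometric_bounds.

(** * The Dirichlet kernel: size near zero and decay *)

Section dirichlet_kernel.
Context {R : realType}.
Implicit Types (u t : R) (n : nat).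

Fixpoint chebyshev n t : R :=
  if n is m.+1 then
    if m is k.+1 then 2 * t * chebyshev m t - chebyshev k t else t
  else 1.

Lemma chebyshev_cos n t : chebyshev n (cos t) = cos (n%:R * t).
Proof.
suff : chebyshev n (cos t) = cos (n%:R * t) /\
       chebyshev n.+1 (cos t) = cos (n.+1%:R * t) by case.
elim: n => [|n [ih1 ih2]]; first by rewrite /= mul0r cos0 mul1r.
split=> //=; rewrite -/(chebyshev n.+1 (cos t)) ih1 ih2.
have -> : n.+2%:R * t = n.+1%:R * t + t by rewrite -[n.+2]addn1 natrD mulrDl mul1r.
have -> : n%:R * t = n.+1%:R * t - t by rewrite -[n.+1]addn1 natrD mulrDl mul1r addrK.
rewrite cosB cosD; ring.
Qed.

(** At t = cos theta this is the Dirichlet kernel 1 + 2 (cos theta + ... + cos (n theta)). Its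
    algebraic form in t makes [dirichlet n (dot x y)] a polynomial in y. *)
Definition dirichlet n t : R := 1 + 2 * \sum_(k < n) chebyshev k.+1 t.

(** The sum telescopes: 2 cos((n+1)t) sin(t/2) = sin((n+1)t + t/2) - sin((n+1)t - t/2). *)
Lemma dirichlet_sin n t :
  dirichlet n (cos t) * sin (t / 2) = sin (n%:R * t + t / 2).
Proof.
elim: n => [|n ih]; first by rewrite /dirichlet big_ord0 mulr0 addr0 mul0r mul1r add0r.
have -> : dirichlet n.+1 (cos t) = dirichlet n (cos t) + 2 * chebyshev n.+1 (cos t).
  by rewrite /dirichlet big_ord_recr/= mulrDr addrA.
rewrite mulrDl ih chebyshev_cos.
have -> : n%:R * t + t / 2 = n.+1%:R * t - t / 2.
  by rewrite -[n.+1]addn1 natrD; field.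
rewrite sinB sinD; ring.
Qed.

(** All the cosines have arguments in [0, 1], so each is at least 1/2. *)
Lemma dirichlet_ge n t : 0 <= t -> n%:R * t <= 1 -> n%:R <= dirichlet n (cos t).
Proof.
move=> t0 nt.
have : \sum_(k < n) 2^-1 <= \sum_(k < n) chebyshev k.+1 (cos t).
  apply: ler_sum => k _; rewrite chebyshev_cos cos_ge_half// mulr_ge0//=.
  by rewrite (le_trans _ nt)// ler_wpM2r// ler_nat.
rewrite sumr_const card_ord -mulr_natr /dirichlet; lra.
Qed.

Lemma dirichlet_le n t : `|dirichlet n (cos t)| <= 2 * n%:R + 1.
Proof.
rewrite /dirichlet (le_trans (ler_normD _ _))// normr1 addrC lerD2r normrM.
rewrite ger0_norm// ler_wpM2l// (le_trans (ler_norm_sum _ _ _))//.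
rewrite -[leRHS]mulr1 mulr_natl -[X in _ *+ X]card_ord -sumr_const.
by apply: ler_sum => k _; rewrite chebyshev_cos cos_max.
Qed.

(** By [dirichlet_sin] the product with sin(t/2) is at most 1 in absolute value, and sin(t/2) >=
    t/8. *)
Lemma dirichlet_decay n t : 0 < t <= pi -> `|dirichlet n (cos t)| * t <= 8.
Proof.
move=> /andP[t0 tpi].
have s0 : t / 2 / 4 <= sin (t / 2) by apply: sin_ge_quarter; lra.
have := dirichlet_sin n t => /(congr1 Num.norm); rewrite normrM => h.
have h1 := sin_max (n%:R * t + t / 2).
rewrite -h (@ger0_norm _ (sin _)) in h1; last by lra.
by have := normr_ge0 (dirichlet n (cos t)); nra.
Qed.

(** Take the least j with n acos u <= 2^j. If j = 0, the trivial bound (2n+1)/n suffices. Otherwise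
    minimality gives n acos u > 2^(j-1), and the decay bound 8/(n acos u) is below 16/2^j. This is
    what sorts the points of the sphere into dyadic caps. *)
Lemma dirichlet_dyadic n u : (0 < n)%N -> -1 <= u <= 1 ->
  exists j, acos u <= 2 ^+ j / n%:R /\ `|dirichlet n u / n%:R| <= 16 / 2 ^+ j.
Proof.
move=> n0 u1; have n0' : 0 < n%:R :> R by rewrite ltr0n.
have n1 : 1 <= n%:R :> R by rewrite ler1n.
have cu : cos (acos u) = u by rewrite acosK// in_itv.
have := acos_ge0 u1; have := acos_lepi u1.
move: cu; set t := acos u => <- tpi t0.
have ex : exists j, t * n%:R <= 2 ^+ j.
  have [j hj] : exists j, t * n%:R <= j%:R.
    exists (Num.Def.archi_bound (t * n%:R)).
    by rewrite ltW// archi_boundP// mulr_ge0// ltW.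
  by exists j; rewrite (le_trans hj)// -natrX ler_nat ltnW// ltn_expl.
case: (ex_minnP ex) => -[|j] hj jmin; [exists 0|exists j.+1]; split;
  rewrite ler_pdivlMr ?exprn_gt0// normrM (@ger0_norm _ n%:R^-1) ?invr_ge0//.
  rewrite expr0 mulr1 ler_pdivrMr// (le_trans (dirichlet_le _ _))//; lra.
have {jmin}jt : 2 ^+ j < t * n%:R.
  by rewrite ltNge; apply/negP => /jmin; rewrite ltnn.
have t1 : 0 < t.
  rewrite lt_neqAle t0 andbT; apply: contraTneq jt => <-.
  by rewrite mul0r -leNgt exprn_ge0.
have := @dirichlet_decay n t; rewrite t1 tpi => /(_ isT) hd.
rewrite mulrAC ler_pdivrMr// exprS.
have := normr_ge0 (dirichlet n (cos t)); nra.
Qed.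

End dirichlet_kernel.

(** * Powers of nonnegative series, for any positive exponent *)

Section nonnegative_series.
Context {R : realType}.
Implicit Types (x p theta : R) (u : R^nat).
Local Open Scope ereal_scope.

Lemma nneseries_geometric x : (0 <= x < 1)%R ->
  \sum_(k <oo) (x ^+ k)%:E = ((1 - x)^-1)%:E.
Proof.
move=> /andP[x0 x1]; apply/cvg_lim => //.
apply: cvg_EFin; first by apply: nearW => n; rewrite sumEFin.
have /(@cvg_geometric_series _ 1%R) : (`|x| < 1)%R by rewrite ger0_norm.
rewrite mul1r; apply: cvg_trans; apply: near_eq_cvg; apply: nearW => n /=.
by rewrite sumEFin /series /=; apply: eq_bigr => k _; rewrite mul1r.
Qed.

Lemma nneseries_term_le (u : (\bar R)^nat) k : (forall i, 0 <= u i) ->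
  u k <= \sum_(i <oo) u i.
Proof.
move=> u0; rewrite (@nneseriesD1 _ u k)//.
by rewrite leeDl// nneseries_ge0.
Qed.

Lemma le_root_powR p x (s : R) :
  (0 < p -> 0 <= x -> x `^ p <= s -> x <= s `^ p^-1)%R.
Proof.
move=> p0 x0 xs.
rewrite -[leLHS]powRr1// -[X in (_ `^ X)%R](mulfV (lt0r_neq0 p0)) powRrM.
apply: ge0_ler_powR; rewrite ?nnegrE ?invr_ge0 ?(ltW p0) ?powR_ge0//.
exact: le_trans (powR_ge0 _ _) xs.
Qed.

(** A substitute for Minkowski that is uniform in p > 0, including p < 1. If s is the series on the
    right, each of its terms is at most s, so u_k <= s^(1/p) theta^k; summing the geometric series
    and raising to the power p gives the claim. *)
Lemma nneseries_poweR_le theta p u :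
  (0 < theta < 1)%R -> (0 < p)%R -> (forall k, 0 <= u k)%R ->
  (\sum_(k <oo) (u k)%:E) `^ p <= (((1 - theta)^-1) `^ p)%:E *
    \sum_(k <oo) ((theta `^ (- p)) ^+ k * u k `^ p)%:E.
Proof.
move=> /andP[th0 th1] p0 u0; pose v k : R := ((theta `^ (- p)) ^+ k * u k `^ p)%R.
have v0 k : 0 <= (v k)%:E.
  by rewrite lee_fin /v mulr_ge0 ?exprn_ge0 ?powR_ge0.
have C0 : (0 < (1 - theta)^-1 `^ p)%R by rewrite powR_gt0// invr_gt0 subr_gt0.
rewrite [X in _ <= _ * X](_ : _ = \sum_(k <oo) (v k)%:E)//.
case sE : (\sum_(k <oo) (v k)%:E) => [s| |]; last 2 first.
- by rewrite gt0_muley ?lte_fin// leey.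
- have : 0 <= \sum_(k <oo) (v k)%:E by rewrite nneseries_ge0.
  by rewrite sE.
have s0 : (0 <= s)%R by rewrite -lee_fin -sE nneseries_ge0.
have us k : (u k <= s `^ p^-1 * theta ^+ k)%R.
  have : (v k <= s)%R.
    by rewrite -lee_fin -sE; exact: (@nneseries_term_le (fun k => (v k)%:E)).
  rewrite /v => vs; rewrite -ler_pdivrMr ?exprn_gt0//.
  apply: le_root_powR => //; first by rewrite divr_ge0// exprn_ge0// ltW.
  rewrite powRM ?invr_ge0 ?exprn_ge0 ?(ltW th0)//.
  rewrite mulrC (_ : (_ ^-1) `^ p = (theta `^ (- p)) ^+ k)%R//.
  rewrite -powR_inv1 ?exprn_ge0 ?(ltW th0)// -powR_mulrn ?(ltW th0)// -!powRrM -powR_mulrn.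
    by rewrite -powRrM; congr (_ `^ _)%R; ring.
  exact: powR_ge0.
have : \sum_(k <oo) (u k)%:E <= (s `^ p^-1 * (1 - theta)^-1)%:E.
  rewrite EFinM -nneseries_geometric ?th1 ?(ltW th0)// -nneseriesZl; last first.
    by move=> k _; rewrite lee_fin exprn_ge0// ltW.
  by apply: lee_nneseries => k _; rewrite -?EFinM lee_fin.
have : 0 <= \sum_(k <oo) (u k)%:E by rewrite nneseries_ge0// => k _ _; rewrite lee_fin.
case: (\sum_(k <oo) (u k)%:E) => // r r0 rs; rewrite !lee_fin in r0 rs.
rewrite poweR_EFin -EFinM lee_fin.
have th2 : (0 <= (1 - theta)^-1)%R by rewrite invr_ge0 subr_ge0 ltW.
apply: (le_trans (ge0_ler_powR (ltW p0) _ _ rs)); rewrite ?nnegrE//.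
  by rewrite mulr_ge0// powR_ge0.
by rewrite powRM ?powR_ge0// -powRrM mulVf ?gt_eqF// powRr1// mulrC.
Qed.

(** When the series converges, the difference is the tail and [nneseries_poweR_le] applies. When it
    diverges, [fine] returns a default value, but then the right-hand side is infinite if w > 0, and
    the left-hand side is zero if w = 0. *)
Lemma fine_nneseries_tail_le theta p (w : R) u m :
  (0 < theta < 1)%R -> (0 < p)%R -> (0 <= w)%R -> (forall k, 0 <= u k)%R ->
  ((`|fine (\sum_(k <oo) (u k)%:E) - \sum_(k < m) u k| `^ p * w)%:E <=
   (((1 - theta)^-1) `^ p)%:E *
    \sum_(k <oo) ((theta `^ (- p)) ^+ k * (u (k + m)%N `^ p * w))%:E).
Proof.
move=> th p0; rewrite le_eqVlt => /predU1P[<-|w0] u0.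
  by rewrite mulr0 mule_ge0 ?lee_fin ?powR_ge0// nneseries_ge0// => k _ _; rewrite !mulr0.
have u0' k : true -> 0 <= (u k)%:E by rewrite lee_fin.
have -> : \sum_(k <oo) ((theta `^ (- p)) ^+ k * (u (k + m)%N `^ p * w))%:E =
    w%:E * \sum_(k <oo) ((theta `^ (- p)) ^+ k * u (k + m)%N `^ p)%:E.
  rewrite -nneseriesZl => [|k _]; last by rewrite lee_fin mulr_ge0 ?exprn_ge0 ?powR_ge0.
  by apply: eq_eseriesr => k _; rewrite -EFinM mulrA; congr EFin; exact: mulrC.
have := nneseries_poweR_le th p0 (fun k => u0 (k + m)%N).
set C := (_ `^ p)%:E; set S := \sum_(k <oo) ((_ ^+ k * _)%R)%:E.
have -> : \sum_(k <oo) (u k)%:E = (\sum_(k < m) u k)%:E + \sum_(k <oo) (u (k + m)%N)%:E.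
  rewrite (nneseries_split 0 m); last by move=> k _; exact: u0'.
  rewrite add0n -(@nneseries_addn _ (fun k => (u k)%:E)); last by move=> k; exact: u0'.
  by rewrite big_mkord sumEFin.
have : 0 <= \sum_(k <oo) (u (k + m)%N)%:E.
  by rewrite nneseries_ge0// => k _ _; exact: u0'.
case: (\sum_(k <oo) _) => [r r0|_|//].
  rewrite -EFinD/= addrAC subrr add0r ger0_norm; last by rewrite -lee_fin.
  by move=> h; rewrite EFinM muleC muleCA lee_pmul2l ?lte_fin// fin_numE.
rewrite poweRyr ?gt_eqF// leye_eq => /eqP h.
by rewrite muleCA h gt0_muley ?lte_fin// leey.
Qed.

Lemma nneseries_poweR_lty theta p (w : R) u :
  (0 < theta < 1)%R -> (0 < p)%R -> (0 < w)%R -> (forall k, 0 <= u k)%R ->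
  \sum_(k <oo) ((theta `^ (- p)) ^+ k * (u k `^ p * w))%:E < +oo ->
  \sum_(k <oo) (u k)%:E < +oo.
Proof.
move=> th p0 w0 u0.
have -> : \sum_(k <oo) ((theta `^ (- p)) ^+ k * (u k `^ p * w))%:E =
    w%:E * \sum_(k <oo) ((theta `^ (- p)) ^+ k * u k `^ p)%:E.
  rewrite -nneseriesZl => [|k _]; last by rewrite lee_fin mulr_ge0 ?exprn_ge0 ?powR_ge0.
  by apply: eq_eseriesr => k _; rewrite -EFinM mulrA; congr EFin; exact: mulrC.
have := nneseries_poweR_le th p0 u0.
set C := (_ `^ p)%:E; set S := \sum_(k <oo) ((_ ^+ k * _)%R)%:E => h.
have S0 : 0 <= S.
  by rewrite nneseries_ge0// => k _ _; rewrite lee_fin mulr_ge0 ?exprn_ge0 ?powR_ge0.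
case: S S0 h => [s s0 h|_ _|//]; last by rewrite gt0_muley ?lte_fin// ltxx.
move=> _; apply: (@lty_poweRy _ _ p); first by rewrite gt_eqF.
by rewrite (le_lt_trans h)// -EFinM ltry.
Qed.

End nonnegative_series.

(** * Geometric convergence of a function series in weighted L_p *)

Section weighted_series.
Context d (T : measurableType d) (R : realType) (mu : {measure set T -> \bar R}).
Variables (D : set T) (w : T -> R) (g : nat -> T -> R).
Hypotheses (mD : measurable D) (mw : measurable_fun D w).
Hypothesis w0 : forall x, D x -> 0 <= w x.
Hypothesis mg : forall k, measurable_fun D (g k).
Hypothesis g0 : forall k x, 0 <= g k x.

(* [fine] makes the value 0 where the series diverges. *)
Definition series_fun (x : T) : R := fine (\sum_(k <oo) (g k x)%:E)%E.

Lemma measurable_series_fun : measurable_fun D series_fun.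
Proof.
apply: (@measurableT_comp _ _ _ _ _ _ fine); first exact: fine_measurable.
apply: ge0_emeasurable_sum => [k x _ _|k _]; first by rewrite lee_fin.
exact/measurable_EFinP.
Qed.

Lemma measurable_powR_weight p (f : T -> R) : measurable_fun D f ->
  measurable_fun D (fun x => (f x `^ p * w x)%:E).
Proof.
move=> mf; apply/measurable_EFinP; apply: measurable_funM => //.
by apply: (@measurableT_comp _ _ _ _ _ _ (@powR R ^~ p)) => //; exact: measurable_powR.
Qed.

Lemma measurable_norm_powR_weight p (f : T -> R) : measurable_fun D f ->
  measurable_fun D (fun x => (`|f x| `^ p * w x)%:E).
Proof.
move=> mf; apply: measurable_powR_weight.
exact: (@measurableT_comp _ _ _ _ _ _ (@Num.norm R R)).
Qed.

Variables (p rho B : R).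
Hypotheses (p0 : 0 < p) (rho01 : 0 < rho < 1).
Local Open Scope ereal_scope.
Hypothesis gB : forall k,
  \int[mu]_(x in D) (g k x `^ p * w x)%:E <= (B * rho ^+ k)%:E.

(** With this choice [c] = theta^(-p) = rho^(-1/2): the loss c^k uses up only half of the decay
    rho^k and leaves the ratio [eta] = rho^(1/2) < 1. *)
Let theta : R := (rho `^ (p *+ 2)^-1)%R.
Let c : R := (theta `^ (- p))%R.
Let eta : R := (rho `^ 2^-1)%R.

Let rho0 : (0 < rho)%R. Proof. by case/andP: rho01. Qed.

Let powR_rho01 (a : R) : (0 < a)%R -> (0 < rho `^ a < 1)%R.
Proof.
move=> a0; rewrite powR_gt0//=.
have [_ rho1] := andP rho01.
have -> : (1 = 1 `^ a)%R by rewrite powR1.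
by apply: gt0_ltr_powR; rewrite ?nnegrE ?(ltW rho0).
Qed.

Let theta01 : (0 < theta < 1)%R.
Proof. by apply: powR_rho01; rewrite invr_gt0 mulrn_wgt0. Qed.

Let eta01 : (0 <= eta < 1)%R.
Proof. by have /andP[/ltW ->] := @powR_rho01 2^-1 ltac:(by []). Qed.

Let c_rho : (c * rho = eta)%R.
Proof.
rewrite /c /theta /eta -powRrM.
have -> : ((p *+ 2)^-1 * - p = - 2^-1)%R.
  by rewrite -mulr_natr; field; rewrite gt_eqF.
have -> : (rho = rho `^ 1)%R by rewrite powRr1// ltW.
rewrite -!powRrM -powRD; last by rewrite (gt_eqF rho0) implybT.
by congr (_ `^ _)%R; field.
Qed.

Let c0 : (0 <= c)%R. Proof. exact: powR_ge0. Qed.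

(** Up to a constant factor, the pointwise bound of [fine_nneseries_tail_le] for the m-th
    remainder. *)
Let majorant m x := \sum_(k <oo) (c ^+ k * (g (k + m)%N x `^ p * w x))%:E.

Let term_ge0 m k x : D x -> 0 <= (c ^+ k * (g (k + m)%N x `^ p * w x))%:E.
Proof.
by move=> Dx; rewrite lee_fin mulr_ge0 ?exprn_ge0// mulr_ge0 ?powR_ge0 ?w0.
Qed.

Let mterm m k : measurable_fun D (fun x => (c ^+ k * (g (k + m)%N x `^ p * w x))%:E).
Proof.
under eq_fun do rewrite EFinM.
by apply: measurable_funeM; exact: measurable_powR_weight.
Qed.

Let majorant_ge0 m x : D x -> 0 <= majorant m x.
Proof. by move=> Dx; apply: nneseries_ge0 => k _ _; exact: term_ge0. Qed.

Let measurable_majorant m : measurable_fun D (majorant m).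
Proof. by apply: ge0_emeasurable_sum => [k x Dx _|k _]; [exact: term_ge0|exact: mterm]. Qed.

(** Termwise integration bounds the k-th term by c^k B rho^(k+m) = B rho^m eta^k. *)
Let integral_majorant m :
  \int[mu]_(x in D) majorant m x <= (B / (1 - eta) * rho ^+ m)%:E.
Proof.
rewrite integral_nneseries//; last by move=> k x; exact: term_ge0.
rewrite mulrAC EFinM -nneseries_geometric// -nneseriesZl; last first.
  by move=> k _; rewrite lee_fin exprn_ge0//; case/andP: eta01.
apply: lee_nneseries => k _.
  by move=> _; apply: integral_ge0 => x; exact: term_ge0.
under eq_integral do rewrite EFinM.
rewrite ge0_integralZl_EFin ?exprn_ge0//; last 2 first.
- by move=> x Dx; rewrite lee_fin mulr_ge0 ?powR_ge0 ?w0.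
- exact: measurable_powR_weight.
apply: (le_trans (lee_wpmul2l _ (gB (k + m)))); first by rewrite lee_fin exprn_ge0.
by rewrite -!EFinM lee_fin -c_rho exprMn exprD le_eqVlt; apply/orP; left; apply/eqP; ring.
Qed.

Lemma integral_series_fun_tail : exists C : R, forall m,
  \int[mu]_(x in D)
     (`|series_fun x - \sum_(k < m) g k x| `^ p * w x)%:E <= (C * rho ^+ m)%:E.
Proof.
exists ((1 - theta)^-1 `^ p * (B / (1 - eta)))%R => m.
apply: (@le_trans _ _ (\int[mu]_(x in D) (((1 - theta)^-1 `^ p)%:E * majorant m x))).
  apply: ge0_le_integral => //.
  - by move=> x Dx; rewrite lee_fin mulr_ge0 ?powR_ge0 ?w0.
  - apply: (@measurable_norm_powR_weight p (fun x => series_fun x - \sum_(k < m) g k x)%R).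
    apply: measurable_funB; first exact: measurable_series_fun.
    by apply: measurable_sum => k; exact: mg.
  - by apply: measurable_funeM; exact: measurable_majorant.
  - by move=> x Dx; apply: (@fine_nneseries_tail_le _ _ _ _ (fun k => g k x)); rewrite ?w0.
rewrite ge0_integralZl_EFin ?powR_ge0//; last by move=> x; exact: majorant_ge0.
by rewrite -mulrA EFinM lee_wpmul2l// lee_fin powR_ge0.
Qed.

(* The series converges almost everywhere on [{w > 0}], where it dominates each term. *)
Lemma integral_series_fun_ge (q : R) k : (0 < q)%R ->
  \int[mu]_(x in D) (g k x `^ q * w x)%:E <=
  \int[mu]_(x in D) (`|series_fun x| `^ q * w x)%:E.
Proof.
move=> q0; apply: ae_ge0_le_integral => //.
- by move=> x Dx; rewrite lee_fin mulr_ge0 ?powR_ge0 ?w0.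
- exact: measurable_powR_weight.
- by move=> x Dx; rewrite lee_fin mulr_ge0 ?powR_ge0 ?w0.
- by apply: measurable_norm_powR_weight; exact: measurable_series_fun.
(* An integrable majorant is finite almost everywhere; where moreover w > 0, [nneseries_poweR_lty]
   turns this into convergence of the series itself. Where w = 0 both integrands vanish. *)
have /(integrable_ae mD) : mu.-integrable D (majorant 0).
  apply/integrableP; split; first exact: measurable_majorant.
  rewrite (@eq_integral _ _ _ _ _ (majorant 0)); last first.
    by move=> x; rewrite inE => Dx; rewrite gee0_abs// majorant_ge0.
  by rewrite (le_lt_trans (integral_majorant 0))// ltry.
apply: filterS => x /[swap] Dx /(_ Dx); rewrite ge0_fin_numE ?majorant_ge0// => mfin.
rewrite lee_fin; have := w0 Dx; rewrite le_eqVlt => /predU1P[<-|wx].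
  by rewrite !mulr0.
rewrite ler_wpM2r ?(ltW wx)//; apply: ge0_ler_powR; rewrite ?nnegrE ?(ltW q0)//.
have u0 i : 0 <= (g i x)%:E by rewrite lee_fin.
rewrite (le_trans _ (ler_norm _))// -lee_fin /series_fun fineK.
  exact: (@nneseries_term_le _ (fun i => (g i x)%:E)).
rewrite ge0_fin_numE ?nneseries_ge0//.
apply: (nneseries_poweR_lty theta01 p0 wx) => //.
apply: le_lt_trans mfin; apply: lee_nneseries => i _; last by rewrite addn0.
by move=> _; have := term_ge0 0 i Dx; rewrite addn0.
Qed.

End weighted_series.

(** * Degree calculus for polynomial functions on the sphere *)

Section polynomial_functions.
Context {R : realType} {d : nat}.
Implicit Types (f g : euclid R d -> R) (n m : nat).

Lemma polys_leq n m f : (n <= m)%N -> polys n f -> polys m f.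
Proof.
by move=> nm [P Pn <-]; exists P => //= a /Pn /leq_trans; exact.
Qed.

Lemma polys_cst (c : R) : polys 0 (fun _ : euclid R d => c).
Proof.
exists (mpoly.mpolyC d c); last by apply/funext => x; exact: mpoly.mevalC.
move=> m; rewrite mpoly.mcoeffC; have [->|] := eqVneq m mpoly.mnm0.
  by rewrite mpoly.mdeg0.
by rewrite mulr0 eqxx.
Qed.

Lemma polys_coord i : polys 1 (fun x : euclid R d => tnth x i).
Proof.
exists (mpoly.mpolyX R (mpoly.mnm1 i)).
  move=> m; rewrite mpoly.mcoeffX; have [<- _|] := eqVneq (mpoly.mnm1 i) m.
    by rewrite mpoly.mdeg1.
  by rewrite eqxx.
by apply/funext => x; exact: mpoly.mevalXU.
Qed.

Lemma polysD n f g : polys n f -> polys n g -> polys n (fun x => f x + g x).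
Proof.
move=> [P Pn <-] [Q Qn <-]; exists (P + Q).
  move=> m; rewrite mpoly.mcoeffD.
  have [->|/Pn//] := eqVneq (mpoly.mcoeff m P) 0.
  by rewrite add0r => /Qn.
by apply/funext => x; exact: mpoly.mevalD.
Qed.

Lemma polysM n m f g :
  polys n f -> polys m g -> polys (n + m) (fun x => f x * g x).
Proof.
move=> [P Pn <-] [Q Qm <-]; exists (P * Q).
  move=> a; rewrite -mpoly.mcoeff_msupp => /mpoly.msuppM_le /allpairsP[[b c]] /=.
  rewrite !mpoly.mcoeff_msupp => -[/Pn bn /Qm cm ->].
  by rewrite mpoly.mdegD leq_add.
by apply/funext => x; exact: mpoly.mevalM.
Qed.

Lemma polysZ n c f : polys n f -> polys n (fun x => c * f x).
Proof. exact: polysM (polys_cst c). Qed.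

Lemma polys_sum (I : Type) (r : seq I) n (F : I -> euclid R d -> R) :
  (forall i, polys n (F i)) -> polys n (fun x => \sum_(i <- r) F i x).
Proof.
move=> Fn; elim: r => [|i r ih].
  by under eq_fun do rewrite big_nil; exact: polys_leq (polys_cst 0).
by under eq_fun do rewrite big_cons; exact: polysD.
Qed.

Lemma polysX n m f : polys n f -> polys (n * m) (fun x => f x ^+ m).
Proof.
move=> fn; elim: m => [|m ih].
  by rewrite muln0; under eq_fun do rewrite expr0; exact: polys_cst.
by rewrite mulnS; under eq_fun do rewrite exprS; exact: polysM.
Qed.

Lemma polys_dot (x : euclid R d) : polys 1 (dot x).
Proof. by apply: polys_sum => i; apply: polysZ; exact: polys_coord. Qed.

Lemma polys_chebyshev n m f : polys m f -> polys (n * m) (fun x => chebyshev n (f x)).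
Proof.
move=> fm; suff : polys (n * m) (fun x => chebyshev n (f x)) /\
  polys (n.+1 * m) (fun x => chebyshev n.+1 (f x)) by case.
elim: n => [|n [ih1 ih2]]; first by rewrite mul1n; split => //; exact: polys_cst.
split=> //; rewrite [X in polys _ X](_ : _ = fun x => 2 * (f x * chebyshev n.+1 (f x)) +
    -1 * chebyshev n (f x)); last first.
  by apply/funext => x; rewrite mulN1r mulrA.
apply: polysD; last by apply/polysZ/(polys_leq _ ih1); rewrite leq_mul2r ltnW ?orbT.
by apply: polysZ; exact: polysM.
Qed.

Lemma polys_dirichlet n f : polys 1 f -> polys n (fun x => dirichlet n (f x)).
Proof.
move=> f1; apply: polysD; first exact: polys_leq (polys_cst 1).
apply/polysZ/polys_sum => k; apply: (@polys_leq (k.+1 * 1)); first by rewrite muln1.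
exact: polys_chebyshev.
Qed.

Lemma measurable_polys n f : polys n f -> measurable_fun setT f.
Proof.
move=> [P _ <-].
under eq_fun do rewrite mpoly.mevalE.
apply: measurable_sum => m; apply: measurable_funM => //.
apply: measurable_prod => i _; apply: measurable_funX.
exact: measurable_tnth.
Qed.

End polynomial_functions.

(** * Spherical caps *)

Section caps.
Context {R : realType} {d : nat}.
Implicit Types (x y : euclid R d) (t : R).

(** Cauchy-Schwarz for unit vectors, by expanding |x + s y|^2 >= 0 with s = 1 and s = -1. *)
Lemma dot_sphere x y : sphere x -> sphere y -> -1 <= dot x y <= 1.
Proof.
have dot_ge0 (z : euclid R d) : 0 <= dot z z by apply: sumr_ge0 => i _; rewrite -expr2 sqr_ge0.
have dot1 (z : euclid R d) : sphere z -> dot z z = 1.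
  by rewrite /sphere/= /norm2 => z1; rewrite -[LHS]sqr_sqrtr// z1 expr1n.
move=> /dot1 xx /dot1 yy.
have h (s : R) : s ^+ 2 = 1 -> 0 <= 1 + 2 * s * dot x y + 1.
  move=> s2.
  have : 0 <= \sum_(i < d) (tnth x i + s * tnth y i) ^+ 2.
    by apply: sumr_ge0 => i _; rewrite sqr_ge0.
  rewrite (_ : \sum_(i < d) _ = dot x x + 2 * s * dot x y + s ^+ 2 * dot y y).
    by rewrite xx yy s2 mulr1.
  rewrite /dot !mulr_sumr -!big_split/=.
  by apply: eq_bigr => i _; ring.
have := h 1 (expr1n _ _); have := h (-1); rewrite sqrrN expr1n => /(_ erefl); lra.
Qed.

Lemma measurable_sphere : measurable (@sphere R d).
Proof.
rewrite (_ : @sphere R d = @norm2 R d @^-1` [set 1])//.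
by rewrite -[X in measurable X]setTI; exact: measurable_norm2.
Qed.

Lemma cap_sphere x t : sphere x -> pi <= t -> cap x t = @sphere R d.
Proof.
move=> x1 tpi; apply/seteqP; split => y; first by case.
move=> y1; split => //; apply: le_trans tpi.
by apply: acos_lepi; exact: dot_sphere.
Qed.

Lemma subset_cap_sphere x t : cap x t `<=` @sphere R d.
Proof. by move=> y []. Qed.

(** For 0 <= t < pi the cap is cut out of the sphere by the closed half-space cos t <= x . y; for
    other t it is empty or the whole sphere. *)
Lemma measurable_cap x t : sphere x -> measurable (cap x t).
Proof.
move=> x1; have [tpi|tpi] := leP pi t.
  by rewrite cap_sphere//; exact: measurable_sphere.
have [t0|t0] := ltP t 0.
  rewrite (_ : cap x t = set0)//; apply/seteqP; split => // y [y1].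
  by move=> /le_lt_trans /(_ t0); rewrite ltNge acos_ge0// dot_sphere.
rewrite (_ : cap x t = @sphere R d `&` (dot x @^-1` `[cos t, +oo[)).
  apply: measurableI; first exact: measurable_sphere.
  rewrite -[X in measurable X]setTI; apply: measurable_polys => //.
  exact: polys_dot.
suff h y : sphere y -> (acos (dot x y) <= t) = (cos t <= dot x y).
  apply/seteqP; split => y [y1]; rewrite /= in_itv/= andbT.
    by rewrite h.
  by rewrite /cap/= h.
move=> y1; have xy := dot_sphere x1 y1.
rewrite -{2}[dot x y](@acosK R) ?in_itv//= !leNgt ltr_cos//= in_itv/=.
- by rewrite t0 ltW.
- by rewrite acos_ge0 ?acos_lepi.
Qed.

End caps.

(** * Masses of caps and the weighted integral of a bump *)

Section weight_mass.
Context {R : realType} {d : nat}.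
Variable w : euclid R d -> R.
Hypothesis hw : doubling_weight w.
Implicit Types (x y : euclid R d) (t : R) (E : set (euclid R d)).

Lemma weight_ge0 y : sphere y -> 0 <= w y.
Proof. by move=> y1; case: hw => + _ _ _; exact. Qed.

Lemma measurable_weight : measurable_fun (@sphere R d) w.
Proof. by case: hw => _ /integrableP[/measurable_EFinP]. Qed.

Lemma wmassE E : measurable E -> E `<=` @sphere R d ->
  (wmass w E)%:E = (\int[@surface R d]_(y in E) (w y)%:E)%E.
Proof.
move=> mE Es; rewrite /wmass /Rintegral fineK//.
apply: (@integrable_fin_num _ _ _ _ _ mE).
by case: hw => _ + _ _; apply: integrableS => //; exact: measurable_sphere.
Qed.

Lemma wmass_ge0 E : E `<=` @sphere R d -> 0 <= wmass w E.
Proof.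
move=> Es; apply: fine_ge0; apply: integral_ge0 => y /Es y1.
by rewrite lee_fin weight_ge0.
Qed.

Variable L : R.
Hypothesis L0 : 0 < L.
Hypothesis hL : doubling_with w L.

Lemma wmass_dyadic x t j : sphere x -> 0 < t ->
  wmass w (cap x (2 ^+ j * t)) <= L ^+ j * wmass w (cap x t).
Proof.
move=> x1 t0; elim: j => [|j ih]; first by rewrite !mul1r.
rewrite !exprS -!mulrA.
apply: (@le_trans _ _ (L * wmass w (cap x (2 ^+ j * t)))); last by rewrite ler_pM2l.
by apply: (hL (b := (x, 2 ^+ j * t))); split => //=; rewrite mulr_gt0 ?exprn_gt0.
Qed.

(** If a cap had mass zero, so would all its dyadic dilates, and one of them is the whole sphere, of
    mass 1. *)
Lemma wmass_cap_gt0 x t : sphere x -> 0 < t -> 0 < wmass w (cap x t).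
Proof.
move=> x1 t0; rewrite lt_neqAle wmass_ge0 ?andbT; last exact: subset_cap_sphere.
apply/eqP => cap0.
have [j hj] : exists j, pi <= 2 ^+ j * t.
  exists (Num.Def.archi_bound (pi / t)); rewrite -ler_pdivrMr//.
  have pt0 : 0 <= pi / t by rewrite divr_ge0 ?pi_ge0 ?ltW.
  rewrite (le_trans (ltW (archi_boundP pt0)))// -natrX ler_nat ltnW// ltn_expl//.
have := wmass_dyadic j x1 t0; rewrite -cap0 mulr0 cap_sphere//.
by case: hw => _ _ _ ->; rewrite ler10.
Qed.

Variables (x : euclid R d) (n r : nat).
Hypotheses (x1 : sphere x) (n0 : (0 < n)%N).

Definition bump y : R := (dirichlet n (dot x y) / n%:R) ^+ (2 * r).

Lemma bump_ge0 y : 0 <= bump y.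
Proof. by rewrite /bump exprM exprn_ge0// sqr_ge0. Qed.

Lemma polys_bump : polys (n * (2 * r)) bump.
Proof.
apply: polysX; rewrite [X in polys _ X](_ : _ = fun y => n%:R^-1 * dirichlet n (dot x y)).
  by apply/polysZ/polys_dirichlet/polys_dot.
by apply/funext => y; rewrite mulrC.
Qed.

Lemma bump_ge1 y : cap x n%:R^-1 y -> 1 <= bump y.
Proof.
move=> [y1 xy]; rewrite /bump.
have xy1 := dot_sphere x1 y1.
apply: exprn_ege1; rewrite ler_pdivlMr ?ltr0n// mul1r.
rewrite -[dot x y](@acosK R) ?in_itv//; apply: dirichlet_ge; first exact: acos_ge0.
by rewrite mulrC -ler_pdivlMr ?ltr0n// div1r.
Qed.

(** With a = 2rp, the p-th power of the bump is dominated by the sum over j of 16^a 2^(-ja) times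
    the indicator of the cap of radius 2^j/n. Doubling bounds the mass of that cap by L^j times the
    mass of the central one. The hypothesis makes the ratio L/2^a at most 1/2, whence the factor
    2. *)
Lemma integral_bump_le p : 0 < p -> L / 2 `^ ((2 * r)%:R * p) <= 2^-1 ->
  (\int[@surface R d]_(y in @sphere R d) (bump y `^ p * w y)%:E <=
   (16 `^ ((2 * r)%:R * p) * 2 * wmass w (cap x n%:R^-1))%:E)%E.
Proof.
move=> p0; set a := (2 * r)%:R * p => La.
set lam := (2 `^ a)^-1.
have a0 : 0 <= a by rewrite mulr_ge0// ltW.
have lam0 : 0 <= lam by rewrite invr_ge0 powR_ge0.
pose C j := cap x (2 ^+ j / n%:R).
have mC j : measurable (C j) by exact: measurable_cap.
have CS j : C j `<=` @sphere R d by exact: subset_cap_sphere.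
pose h j y : \bar R := ((16 `^ a * lam ^+ j) * (\1_(C j) y * w y))%:E.
have h0 j y : sphere y -> (0 <= h j y)%E.
  move=> y1; rewrite lee_fin mulr_ge0//.
    by rewrite mulr_ge0 ?powR_ge0 ?exprn_ge0.
  by rewrite mulr_ge0 ?weight_ge0// indicE.
have mCw j : measurable_fun (@sphere R d) (fun y => (\1_(C j) y * w y)%:E).
  apply/measurable_EFinP/measurable_funM; last exact: measurable_weight.
  exact: measurable_indic.
have mh j : measurable_fun (@sphere R d) (h j).
  rewrite /h; under eq_fun do rewrite EFinM; exact: measurable_funeM.
apply: (@le_trans _ _ (\int[@surface R d]_(y in @sphere R d) \sum_(j <oo) h j y)%E).
  apply: ge0_le_integral => //.
  - exact: measurable_sphere.
  - by move=> y y1; rewrite lee_fin mulr_ge0 ?powR_ge0 ?weight_ge0.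
  - apply: measurable_powR_weight; first exact: measurable_weight.
    by apply: measurable_funTS; exact: measurable_polys polys_bump.
  - apply: ge0_emeasurable_sum => [j y y1 _|j _]; [exact: h0|exact: mh].
  (* The single term with the index j given by [dirichlet_dyadic] already dominates at y. *)
  move=> y y1; have [j [jle jb]] := dirichlet_dyadic n0 (dot_sphere x1 y1).
  apply: (@le_trans _ _ (h j y)); last first.
    by apply: (@nneseries_term_le _ (h ^~ y)) => i; exact: h0.
  rewrite lee_fin mulrA indicE mem_set//= mulr1 ler_wpM2r ?weight_ge0//.
  rewrite /bump exprM -real_normK ?num_real// -exprM -powR_mulrn// -powRrM -/a.
  apply: (le_trans (ge0_ler_powR a0 _ _ jb)); rewrite ?nnegrE ?divr_ge0 ?exprn_ge0//.
  rewrite powRM ?invr_ge0 ?exprn_ge0// /lam -exprVn.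
  rewrite -[2^-1 ^+ j]powR_mulrn ?invr_ge0//.
  rewrite -powRrM mulrC -[2^-1]powR_inv1// -powRrM -powRN -[(2 `^ _) ^+ j]powR_mulrn ?powR_ge0//.
  by rewrite -powRrM mulrC le_eqVlt; apply/orP; left; apply/eqP; congr (_ * _ `^ _); ring.
rewrite integral_nneseries//; last exact: measurable_sphere.
have -> : (16 `^ a * 2 * wmass w (cap x n%:R^-1))%:E =
    ((16 `^ a * wmass w (cap x n%:R^-1))%:E * \sum_(j <oo) ((2^-1) ^+ j)%:E)%E.
  rewrite nneseries_geometric; last by lra.
  by rewrite -EFinM; congr EFin; rewrite mulrAC; congr (_ * _); field.
rewrite -nneseriesZl => [|j _]; last by rewrite lee_fin exprn_ge0.
apply: lee_nneseries => j _; first by move=> _; apply: integral_ge0 => y; exact: h0.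
rewrite /h; under eq_integral do rewrite EFinM.
rewrite ge0_integralZl_EFin//; last 3 first.
- exact: measurable_sphere.
- by move=> y y1; rewrite lee_fin mulr_ge0 ?weight_ge0// indicE.
- by rewrite mulr_ge0 ?powR_ge0 ?exprn_ge0.
have -> : (\int[@surface R d]_(y in @sphere R d) (\1_(C j) y * w y)%:E)%E =
    (wmass w (C j))%:E.
  rewrite wmassE// -[in RHS](setIidr (CS j)) integral_mkcondr.
  apply: eq_integral => y _; rewrite restrict_EFin; congr EFin.
  by rewrite patchE indicE; case: ifP; rewrite ?mul1r ?mul0r.
rewrite -!EFinM lee_fin -!mulrA ler_pM2l ?powR_gt0//.
have n1 : 0 < n%:R^-1 :> R by rewrite invr_gt0 ltr0n.
apply: (@le_trans _ _ (lam ^+ j * (L ^+ j * wmass w (cap x n%:R^-1)))).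
  by rewrite ler_wpM2l ?exprn_ge0//; exact: wmass_dyadic.
rewrite mulrA -exprMn [leRHS]mulrC ler_wpM2r ?wmass_ge0//; first exact: subset_cap_sphere.
by rewrite lerXn2r ?nnegrE ?mulr_ge0// ?(ltW L0)// mulrC.
Qed.

End weight_mass.

(** * Besov membership from the decay of best approximations *)

Section besov_criteria.
Context {R : realType} {d : nat} (w : euclid R d -> R).
Implicit Types (f : euclid R d -> R) (p : R).

Lemma best_approx_ge0 n p f : (0 <= best_approx w n p f)%E.
Proof. by apply: le_ereal_inf_tmp => _ [g _ <-]; exact: poweR_ge0. Qed.

(** For finite tau = t the terms are at most C^t x^j with x = 2^(-(mu - nu)t) < 1; for tau infinite
    the supremum is at most C. *)
Lemma besov_seminorm_lty (nu mu C p : R) (tau : \bar R) f :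
  nu < mu -> 0 <= C -> (0 < tau)%E ->
  (forall j, (best_approx w (2 ^ j) p f <= (C * 2 `^ (- (j%:R * mu)))%:E)%E) ->
  (besov_seminorm w nu tau p f < +oo)%E.
Proof.
move=> numu C0 tau0 fC.
have E0 j := best_approx_ge0 (2 ^ j) p f.
case: tau tau0 => [t|_|//]; last first.
  rewrite /=; apply: (@le_lt_trans _ _ C%:E); last exact: ltry.
  apply: ge_ereal_sup => _ [j _ <-].
  apply: (le_trans (lee_wpmul2l _ (fC j))); first by rewrite lee_fin powR_ge0.
  rewrite -EFinM lee_fin mulrCA ler_piMr// -powRD; last by rewrite pnatr_eq0 implybT.
  rewrite -mulrBr -[leRHS](powRr0 2) ler_powR ?ler1n//.
  by rewrite mulr_ge0_le0// subr_le0 ltW.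
rewrite lte_fin => t0 /=; apply: poweR_lty.
pose x : R := 2 `^ (- ((mu - nu) * t)).
have x01 : 0 <= x < 1.
  rewrite powR_ge0/= /x powRN invf_lt1 ?powR_gt0//.
  have z0 : 0 < (mu - nu) * t by rewrite mulr_gt0// subr_gt0.
  have := @gt0_ltr_powR _ _ z0 1 2; rewrite powR1; apply; rewrite ?nnegrE//.
  by rewrite ltr1n.
apply: (@le_lt_trans _ _ ((C `^ t)%:E * \sum_(j <oo) (x ^+ j)%:E)%E); last first.
  by rewrite nneseries_geometric// -EFinM ltry.
rewrite -nneseriesZl => [|j _]; last by rewrite lee_fin exprn_ge0//; case/andP: x01.
apply: lee_nneseries => j _.
  by move=> _; rewrite mule_ge0 ?lee_fin ?powR_ge0 ?poweR_ge0.
have : (best_approx w (2 ^ j) p f `^ t <= (C * 2 `^ (- (j%:R * mu)))%:E `^ t)%E.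
  apply: gt0_ler_poweR => //; rewrite ?in_itv/= ?leey ?E0 ?(ltW t0)//.
  by rewrite andbT lee_fin mulr_ge0 ?powR_ge0.
move=> /(lee_wpmul2l _) /le_trans; apply; first by rewrite lee_fin powR_ge0.
rewrite poweR_EFin -!EFinM lee_fin powRM ?powR_ge0// mulrCA.
rewrite ler_wpM2l ?powR_ge0// -powRrM -powRD; last by rewrite pnatr_eq0 implybT.
rewrite -powR_mulrn ?powR_ge0// /x -powRrM le_eqVlt; apply/orP; left; apply/eqP.
by congr (_ `^ _); ring.
Qed.

Lemma wnorm_lty (q : R) f : 0 < q -> (wnorm w q f < +oo)%E ->
  exists M : R, (\int[@surface R d]_(x in @sphere R d) (`|f x| `^ q * w x)%:E <= M%:E)%E.
Proof.
rewrite /wnorm => q0 /lty_poweRy; rewrite invr_eq0 gt_eqF// => /(_ isT).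
set I := (\int[_]_(x in _) _)%E; case: I => [M _|//|_].
- by exists M.
- by exists 0; rewrite leNye.
Qed.

Lemma wnorm_le p f (M : R) : 0 < p -> 0 <= M ->
  (\int[@surface R d]_(x in @sphere R d) (`|f x| `^ p * w x)%:E <= M%:E)%E ->
  (forall x, sphere x -> 0 <= w x) ->
  (wnorm w p f <= (M `^ p^-1)%:E)%E.
Proof.
move=> p0 M0 fM w0; rewrite -poweR_EFin; apply: gt0_ler_poweR => //.
- by rewrite invr_ge0 ltW.
- rewrite in_itv/= leey andbT; apply: integral_ge0 => x x1.
  by rewrite lee_fin mulr_ge0 ?powR_ge0 ?w0.
- by rewrite in_itv/= leey andbT lee_fin.
Qed.

End besov_criteria.

(** * Geometric growth and the choice of the kernel exponent *)

Lemma geometric_unbounded {R : realType} (b x M : R) : 0 < b -> 1 < x ->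
  exists k : nat, M < b * x ^+ k.
Proof.
move=> b0 x1.
have [k hk] : exists k : nat, `|M| / b < (x - 1) *+ k.
  exists (Num.Def.archi_bound (`|M| / b / (x - 1))).
  have x10 : 0 < x - 1 by rewrite subr_gt0.
  rewrite -mulr_natl -ltr_pdivrMr//.
  by apply: archi_boundP; rewrite !divr_ge0 ?(ltW b0) ?(ltW x10).
exists k; rewrite (le_lt_trans (ler_norm M))// mulrC -ltr_pdivrMr//.
apply: (lt_le_trans hk); clear hk.
(* Bernoulli's inequality. *)
have : (x - 1) *+ k + 1 <= x ^+ k.
  elim: k => [|k ih]; first by rewrite mulr0n add0r.
  rewrite mulrS exprS.
  have : 0 <= (x - 1) *+ k by rewrite mulrn_wge0// subr_ge0 ltW.
  nra.
by apply: le_trans; rewrite lerDl.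
Qed.

(** Provides the power r for which the kernel decay beats the doubling constant, as
    [integral_bump_le] requires: take 2^N > 2L and then r > N/p. *)
Lemma exists_kernel_exponent {R : realType} (L p : R) : 0 < L -> 0 < p ->
  exists r : nat, L / 2 `^ ((2 * r)%:R * p) <= 2^-1.
Proof.
move=> L0 p0.
have [N hN] : exists N : nat, 2 * L < 1 * 2 ^+ N.
  by apply: geometric_unbounded; rewrite ?ltr1n.
exists (Num.Def.archi_bound (N%:R / p)).
set r := Num.Def.archi_bound _.
have rN : N%:R <= (2 * r)%:R * p.
  have : N%:R / p < r%:R by apply: archi_boundP; rewrite divr_ge0 ?(ltW p0).
  rewrite ltr_pdivrMr// => /ltW /le_trans; apply.
  by rewrite ler_wpM2r ?(ltW p0)// ler_nat leq_pmull.
rewrite ler_pdivrMr ?powR_gt0// mulrC ler_pdivlMr// mulrC (le_trans (ltW hN))// mul1r.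
by rewrite -powR_mulrn// ler_powR ?ler1n.
Qed.

(** * Bumps normalized in L_{p,w}, and their L_{q,w} size *)

Section normalized_bump.
Context {R : realType} {d : nat} (w : euclid R d -> R) (hw : doubling_weight w).
Variables (L : R) (L0 : 0 < L) (hL : doubling_with w L).
Variables (p : R) (r : nat) (p0 : 0 < p).
Hypothesis Lr : L / 2 `^ ((2 * r)%:R * p) <= 2^-1.
Variables (x : euclid R d) (x1 : sphere x) (mu : R) (k : nat).

Let W : R := wmass w (cap x (2 ^ k)%:R^-1).

Let n_gt0 : (0 < 2 ^ k)%N. Proof. by rewrite expn_gt0. Qed.

Let W0 : 0 < W.
Proof. by apply: (wmass_cap_gt0 hw L0 hL) => //; rewrite invr_gt0 ltr0n. Qed.

(** The first factor makes the L_{p,w} norm of the bump bounded uniformly in k, by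
    [integral_bump_le]; the second imposes the decay 2^(-k mu). *)
Let a : R := W `^ (- p^-1) * 2 `^ (- (k%:R * mu)).

Definition normalized_bump (y : euclid R d) : R := a * bump x (2 ^ k) r y.

Let a_ge0 : 0 <= a. Proof. by rewrite mulr_ge0 ?powR_ge0. Qed.

Let a_powR s : a `^ s = W `^ (- (s / p)) * (2 `^ (- (mu * s))) ^+ k.
Proof.
rewrite powRM ?powR_ge0// -!powRrM -powR_mulrn ?powR_ge0// -powRrM.
by congr (_ `^ _ * _ `^ _); ring.
Qed.

Lemma normalized_bump_ge0 y : 0 <= normalized_bump y.
Proof. by rewrite mulr_ge0// bump_ge0. Qed.

(** The degree 2^k * 2r is rounded up to a power of two, to match the dyadic indices of the Besov
    seminorm. *)
Lemma polys_normalized_bump : polys (2 ^ (k + 2 * r)) normalized_bump.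
Proof.
apply/polysZ/(polys_leq _ (polys_bump _ _ _)).
by rewrite expnD leq_mul2l ltnW ?orbT// ltn_expl.
Qed.

Lemma measurable_normalized_bump : measurable_fun (@sphere R d) normalized_bump.
Proof. by apply: measurable_funTS; exact: measurable_polys polys_normalized_bump. Qed.

Lemma integral_normalized_bump_le :
  (\int[@surface R d]_(y in @sphere R d) (normalized_bump y `^ p * w y)%:E <=
   (16 `^ ((2 * r)%:R * p) * 2 * (2 `^ (- (mu * p))) ^+ k)%:E)%E.
Proof.
under eq_integral do rewrite powRM ?bump_ge0// -mulrA EFinM.
rewrite ge0_integralZl_EFin ?powR_ge0//; last 3 first.
- exact: measurable_sphere.
- by move=> y y1; rewrite lee_fin mulr_ge0 ?powR_ge0 ?(weight_ge0 hw).
- apply: measurable_powR_weight; first exact: measurable_weight hw.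
  by apply: measurable_funTS; exact: measurable_polys (polys_bump _ _ _).
have := integral_bump_le hw L0 hL x1 n_gt0 p0 Lr.
move=> /(lee_wpmul2l _) /le_trans; apply; first by rewrite lee_fin powR_ge0.
rewrite -EFinM lee_fin a_powR divff ?gt_eqF// powR_inv1 ?(ltW W0)// -/W.
rewrite le_eqVlt; apply/orP; left; apply/eqP; field.
by rewrite gt_eqF.
Qed.

(** The bump is at least 1 on its cap, so the integral is at least a^q W = W^(1 - q/p) 2^(-k mu q).
    As 1 - q/p < 0, the upper bound on W becomes a lower bound, and s(q/p - 1) = q s(1/p - 1/q). *)
Lemma integral_normalized_bump_ge (c s q : R) : 0 < c -> p < q ->
  W <= c * (2 ^ k)%:R `^ (- s) ->
  ((c `^ (1 - q / p) * (2 `^ (q * (s * (p^-1 - q^-1) - mu))) ^+ k)%:E <=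
   \int[@surface R d]_(y in @sphere R d) (normalized_bump y `^ q * w y)%:E)%E.
Proof.
move=> c0 pq Wle; have q0 : 0 < q by exact: lt_trans pq.
have mcap : measurable (cap x (2 ^ k)%:R^-1) by exact: measurable_cap.
have mw := measurable_weight hw.
have mg := measurable_powR_weight mw q measurable_normalized_bump.
have Gge0 y : sphere y -> (0 <= (normalized_bump y `^ q * w y)%:E)%E.
  by move=> y1; rewrite lee_fin mulr_ge0 ?powR_ge0 ?(weight_ge0 hw).
have capS := @subset_cap_sphere _ _ x (2 ^ k)%:R^-1.
apply: (@le_trans _ _ (\int[@surface R d]_(y in cap x (2 ^ k)%:R^-1)
    (normalized_bump y `^ q * w y)%:E)%E); last first.
  by apply: ge0_subset_integral => //; exact: measurable_sphere.
apply: (@le_trans _ _ (\int[@surface R d]_(y in cap x (2 ^ k)%:R^-1)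
    ((a `^ q)%:E * (w y)%:E))%E); last first.
  apply: ge0_le_integral => //.
  - by move=> y /capS y1; rewrite lee_fin mulr_ge0 ?powR_ge0 ?(weight_ge0 hw).
  - apply: measurable_funeM; apply/measurable_EFinP.
    exact: measurable_funS measurable_sphere capS mw.
  - exact: measurable_funS measurable_sphere capS mg.
  - move=> y xy; rewrite -EFinM lee_fin ler_wpM2r ?(weight_ge0 hw)//; first exact: capS.
    apply: ge0_ler_powR; rewrite ?nnegrE ?normalized_bump_ge0 ?(ltW q0)//.
    by rewrite -[leLHS]mulr1 ler_wpM2l// bump_ge1.
rewrite ge0_integralZl_EFin ?powR_ge0//; last 2 first.
- by move=> y /capS y1; rewrite lee_fin (weight_ge0 hw).
- by apply/measurable_EFinP; exact: measurable_funS measurable_sphere capS mw.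
rewrite -(wmassE hw)// -EFinM lee_fin -/W a_powR.
have qp : 0 < q / p - 1 by rewrite subr_gt0 ltr_pdivlMr// mul1r.
have -> : W `^ (- (q / p)) * (2 `^ (- (mu * q))) ^+ k * W =
    W `^ (1 - q / p) * (2 `^ (- (mu * q))) ^+ k.
  rewrite mulrAC; congr (_ * _).
  rewrite -{2}[W]powRr1 ?(ltW W0)// -powRD; last by rewrite (gt_eqF W0) implybT.
  by rewrite addrC.
set V := c * _ in Wle.
have V0 : 0 < V by rewrite mulr_gt0// powR_gt0// ltr0n.
apply: (@le_trans _ _ (V `^ (1 - q / p) * (2 `^ (- (mu * q))) ^+ k)); last first.
  rewrite ler_wpM2r ?exprn_ge0 ?powR_ge0// -opprB !powRN.
  rewrite lef_pV2 ?posrE ?powR_gt0//.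
  by apply: ge0_ler_powR; rewrite ?nnegrE ?(ltW qp) ?(ltW W0) ?(ltW V0).
rewrite /V powRM ?powR_ge0 ?(ltW c0)// -mulrA ler_wpM2l ?powR_ge0//.
rewrite natrX -powRrM -!powR_mulrn// -?powRrM -?powRD ?powR_ge0 ?pnatr_eq0 ?implybT//.
rewrite le_eqVlt; apply/orP; left; apply/eqP; congr (_ `^ _); field.
by rewrite !gt_eqF.
Qed.

End normalized_bump.

(** * Assembly of the counterexample *)

Theorem mainTheorem8 (R : realType) (d : nat) (hd : (2 <= d)%N) (p q : R)
  (hp : 0 < p) (hpq : p < q) (w : d.-tuple (measurableTypeR R) -> R)
  (hw : doubling_weight w) (sw : R) (hsw : is_growth_exponent w sw)
  (hmin : exists2 c : R, 0 < c & forall n : nat, (0 < n)%N ->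
     exists x : d.-tuple (measurableTypeR R),
       [/\ sphere x,
           forall y, sphere y ->
             wmass w (cap x n%:R^-1) <= wmass w (cap y n%:R^-1) &
           wmass w (cap x n%:R^-1) <= c * n%:R `^ (- sw)])
  (nu' : R) (hnu'0 : 0 < nu') (hnu' : nu' < sw * (p^-1 - q^-1)) :
  exists f : d.-tuple (measurableTypeR R) -> R,
    (forall tau : \bar R, (0 < tau)%E -> besov w nu' tau p f) /\
    ~ Lpw w q f.
Proof.
have [_ _ [L [L0 hL]] _] := hw.
have [c c0 hc] := hmin.
have [r Lr] := exists_kernel_exponent L0 hp.
have /choice[X hX] : forall k, exists x : euclid R d, sphere x /\
    wmass w (cap x (2 ^ k)%:R^-1) <= c * (2 ^ k)%:R `^ (- sw).
  by move=> k; have [|x [x1 _ xc]] := hc (2 ^ k)%N; [rewrite expn_gt0|exists x].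
have X1 k : sphere (X k) by case: (hX k).
set nu := sw * _ in hnu'.
(* mu > nu' will make the Besov sums converge, and mu < nu will make the L_{q,w} norms of the bumps
   unbounded. *)
pose mu := (nu' + nu) / 2.
have [nu'mu munu] : nu' < mu /\ mu < nu by rewrite /mu; split; lra.
pose g k := normalized_bump w p r (X k) mu k.
have g0 k y : 0 <= g k y by exact: normalized_bump_ge0.
have mg k : measurable_fun (@sphere R d) (g k) by exact: measurable_normalized_bump.
have mw := measurable_weight hw.
have ms := @measurable_sphere R d.
have w0 := @weight_ge0 _ _ _ hw.
have q0 : 0 < q by exact: lt_trans hpq.
pose rho : R := 2 `^ (- (mu * p)).
have rho01 : 0 < rho < 1.
  rewrite powR_gt0//= /rho powRN invf_lt1 ?powR_gt0//.
  have z0 : 0 < mu * p by rewrite mulr_gt0// (lt_trans hnu'0).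
  have := @gt0_ltr_powR _ _ z0 1 2; rewrite powR1; apply; rewrite ?nnegrE//.
  by rewrite ltr1n.
have gB k := integral_normalized_bump_le hw L0 hL hp Lr (X1 k) mu k.
have [C hC] := integral_series_fun_tail ms mw w0 mg g0 hp rho01 gB.
pose f := series_fun g; exists f.
have C0 : 0 <= C.
  rewrite -lee_fin (le_trans _ (le_trans (hC 0%N) _)) ?expr0 ?mulr1//.
  by apply: integral_ge0 => y y1; rewrite lee_fin mulr_ge0 ?powR_ge0 ?w0.
split; last first.
  move=> [_ /(wnorm_lty q0)[M hM]].
  have x1 : 1 < 2 `^ (q * (nu - mu)).
    have z0 : 0 < q * (nu - mu) by rewrite mulr_gt0// subr_gt0.
    have := @gt0_ltr_powR R _ z0 1 2; rewrite powR1; apply; rewrite ?nnegrE//.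
    by rewrite ltr1n.
  (* A finite L_{q,w} norm would bound the q-integrals of all bumps by M, but their lower bounds
     grow like 2^(k q (nu - mu)). *)
  have [k] := @geometric_unbounded _ _ _ M (powR_gt0 (1 - q / p) c0) x1.
  apply/negP; rewrite -leNgt -lee_fin; apply: le_trans hM.
  apply: le_trans (integral_series_fun_ge ms mw w0 mg g0 hp rho01 gB k q0).
  exact: (integral_normalized_bump_ge hw L0 hL r hp (X1 k) mu c0 hpq (hX k).2).
have tail m : (wnorm w p (f \- (fun y => \sum_(k < m) g k y))%R <=
    (C `^ p^-1 * 2 `^ (- (m%:R * mu)))%:E)%E.
  have -> : C `^ p^-1 * 2 `^ (- (m%:R * mu)) = (C * rho ^+ m) `^ p^-1.
    rewrite powRM ?exprn_ge0 ?powR_ge0// -powR_mulrn ?powR_ge0// /rho -!powRrM.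
    by congr (_ * _ `^ _); field; rewrite gt_eqF.
  apply: wnorm_le => //; last exact: hC.
  by rewrite mulr_ge0 ?exprn_ge0 ?powR_ge0.
have fp : (wnorm w p f < +oo)%E.
  apply: le_lt_trans (ltry (C `^ p^-1 * 2 `^ (- (0%:R * mu)))).
  rewrite [X in wnorm w p X](_ : f = f \- (fun y => \sum_(k < 0) g k y)) ?tail//.
  by apply/funext => y /=; rewrite big_ord0 subr0.
move=> tau tau0; split; first by split => //; exact: measurable_series_fun.
rewrite lte_add_pinfty//.
(* The extra factor 2^(2r mu) pays for the shift by 2r between the index k of a bump and its degree
   2^(k + 2r). *)
pose C' := C `^ p^-1 * 2 `^ ((2 * r)%:R * mu).
apply: (besov_seminorm_lty (mu := mu) (C := C')) => //.
  by rewrite mulr_ge0 ?powR_ge0.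
(* The bumps with k < m have degree at most 2^j. The subtraction is truncated: for j < 2r the
   approximant is the empty sum, and j <= 2r + m holds in either case. *)
move=> j; pose m := (j - 2 * r)%N.
apply: (@le_trans _ _ (wnorm w p (f \- (fun y => \sum_(k < m) g k y))%R)).
  apply: ereal_inf_lbound; exists (fun y => \sum_(k < m) g k y) => //.
  apply: polys_sum => k; apply: polys_leq (polys_normalized_bump _ _ _ _ _ _).
  by rewrite leq_exp2l//; have := ltn_ord k; rewrite /m ltn_subRL addnC; exact: ltnW.
apply: (le_trans (tail m)); rewrite lee_fin /C' -mulrA ler_wpM2l ?powR_ge0//.
rewrite -powRD ?pnatr_eq0 ?implybT// ler_powR ?ler1n//.
have jm : j%:R <= (2 * r)%:R + m%:R :> R by rewrite -natrD ler_nat -leq_subLR.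
rewrite -mulrBl -mulNr ler_wpM2r ?(ltW (lt_trans hnu'0 nu'mu))//.
by rewrite lerBrDr addrC lerBlDr.
Qed.
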